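(* Let $\varepsilon>0$, $\tau>0$, $\kappa\ge 0$. Let $u_0\in H^1(\Omega)$, let $\boldsymbol u^0\in\mathcal M_N$ be the grid function obtained by projecting $u_0$ onto the grid $\Omega_N$, and let $n\ge 0$. Let $\boldsymbol u^{n},\boldsymbol u_{n,1},\boldsymbol u^{n+1}\in\mathcal M_N$ be the numerical solution (at step $n$, at the intermediate stage, and at step $n+1$) computed by the ERK2 scheme started from $\boldsymbol u^0$, i.e. $$\boldsymbol u_{n,1}=\phi_0(\tau L_\kappa)\boldsymbol u^n+\tau\phi_1(\tau L_\kappa)N_\kappa(\boldsymbol u^n),\qquad \boldsymbol u^{n+1}=\phi_0(\tau L_\kappa)\boldsymbol u^n+\tfrac12\tau\phi_1(\tau L_\kappa)\bigl(N_\kappa(\boldsymbol u^n)+N_\kappa(\boldsymbol u_{n,1})\bigr).$$ Put $$M_n:=\max\{\|\boldsymbol u^n\|_\infty,\|\boldsymbol u_{n,1}\|_\infty,\|\boldsymbol u^{n+1}\|_\infty\},\qquad \beta:=\frac{3M_n^2-1}{2}.$$ If $$\kappa\ \ge\ \max\Bigl\{2\beta-\frac{(3-\sqrt2)\,h^2}{3\pi^2\tau},\,0\Bigr\},$$ then $$E_N(\boldsymbol u_{n,1})\le E_N(\boldsymbol u^n)\quad\text{and}\quad E_N(\boldsymbol u^{n+1})\le E_N(\boldsymbol u^n).$$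
   Context: Grid: $L>0$, $\Omega=(0,L)^3$ with periodic boundary conditions, $N$ a positive even integer, $h=L/N$, $\mu=2\pi/L$. The nodes are $\Omega_N=\{(ph,qh,rh):0\le p,q,r\le N-1\}$, and $\mathcal M_N$ is the space of real-valued $N$-periodic (in each index) grid functions $\boldsymbol v=(v_{p,q,r})$. Let $\widehat{\mathcal S}_N=\{(k,\ell,m)\in\mathbb Z^3:-N/2\le k,\ell,m\le N/2-1\}$. Each grid function has the discrete Fourier expansion $f_{p,q,r}=\sum_{(k,\ell,m)\in\widehat{\mathcal S}_N}\hat f_{k,\ell,m}e^{\mathrm i\mu(kx_p+\ell y_q+mz_r)}$ with $x_p=ph$, $y_q=qh$, $z_r=rh$ and $\hat f_{k,\ell,m}=N^{-3}\sum_{p,q,r}f_{p,q,r}e^{-\mathrm i\mu(kx_p+\ell y_q+mz_r)}$. Discrete operators: $D_x$, $D_y$, $D_z$ multiply $\hat f_{k,\ell,m}$ by $\mathrm i\mu k$, $\mathrm i\mu\ell$, $\mathrm i\mu m$; $\nabla_N\boldsymbol f=(D_x\boldsymbol f,D_y\boldsymbol f,D_z\boldsymbol f)$; $\Delta_N=D_x^2+D_y^2+D_z^2$ multiplies $\hat f_{k,\ell,m}$ by $-\lambda_{k,\ell,m}$, $\lambda_{k,\ell,m}=\mu^2(k^2+\ell^2+m^2)$. Inner product and norms: $\langle\boldsymbol f,\boldsymbol g\rangle=h^3\sum_{p,q,r}f_{p,q,r}g_{p,q,r}^*=|\Omega|\sum\hat f_{k,\ell,m}\hat g_{k,\ell,m}^*$,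 $\|\boldsymbol f\|_2=\langle\boldsymbol f,\boldsymbol f\rangle^{1/2}$ (for vector-valued grid functions sum the squares over components, so $\|\nabla_N\boldsymbol f\|_2^2=|\Omega|\sum\lambda_{k,\ell,m}|\hat f_{k,\ell,m}|^2$), $\|\boldsymbol f\|_\infty=\max|f_{p,q,r}|$. Nonlinearity and operators: $F(u)=\frac14(u^2-1)^2$, $f(u)=F'(u)=u^3-u$ (applied pointwise); $L_\kappa=\varepsilon^2\Delta_N^2-\kappa\Delta_N$, with eigenvalues $\Lambda_{k,\ell,m}=\varepsilon^2\lambda_{k,\ell,m}^2+\kappa\lambda_{k,\ell,m}$; $N_\kappa(\boldsymbol u)=\Delta_Nf(\boldsymbol u)-\kappa\Delta_N\boldsymbol u$. $\phi_0(z)=e^{-z}$, $\phi_1(z)=(1-e^{-z})/z$ with $\phi_1(0)=1$; $\phi_i(\tau L_\kappa)$ multiplies $\hat f_{k,\ell,m}$ by $\phi_i(\tau\Lambda_{k,\ell,m})$. Discrete energy: $E_N(\boldsymbol u)=\frac{\varepsilon^2}{2}\|\nabla_N\boldsymbol u\|_2^2+\langle F(\boldsymbol u),1\rangle$. *)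

(* Defs.v *)
From HB Require Import structures.
From mathcomp Require Import all_boot all_order all_algebra.
From mathcomp.real_closed Require Import complex.
From mathcomp Require Import all_classical all_reals all_analysis.
Set Implicit Arguments.
Unset Strict Implicit.
Unset Printing Implicit Defensive.
Import Order.TTheory GRing.Theory Num.Theory.
Import numFieldNormedType.Exports.
Local Open Scope classical_set_scope.
Local Open Scope ring_scope.

(** ** The Sobolev space H^1 on the open cube (0, L)^3 *)

Definition Omega {R : realType} (L : R) : set (R * R * R) :=
  [set x | [/\ 0 < x.1.1 < L, 0 < x.1.2 < L & 0 < x.2 < L]].

Definition leb3 {R : realType} :=
  ((@lebesgue_measure R \x @lebesgue_measure R) \x @lebesgue_measure R)%E.

Definition L2 {R : realType} (L : R) (u : R * R * R -> R) : Prop :=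
  measurable_fun (Omega L) u /\
  (\int[leb3]_(x in Omega L) ((u x ^+ 2)%:E) < +oo)%E.

Definition basis3 {R : realType} (i : 'I_3) : R * R * R :=
  ((i == 0%N :> nat)%:R, (i == 1%N :> nat)%:R, (i == 2%N :> nat)%:R).

Fixpoint Ck {R : realType} (k : nat) (phi : R * R * R -> R) : Prop :=
  continuous phi /\
  if k is k'.+1 then
    forall i : 'I_3, (forall x, derivable phi x (basis3 i)) /\
                     Ck k' (fun x => 'D_(basis3 i) phi x)
  else True.

Definition test_function {R : realType} (L : R) (phi : R * R * R -> R) : Prop :=
  (forall k, Ck k phi) /\
  exists K : set (R * R * R),
    [/\ compact K, K `<=` Omega L & forall x, ~ K x -> phi x = 0].

Definition weak_derivative {R : realType} (L : R) (i : 'I_3)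
    (u g : R * R * R -> R) : Prop :=
  forall phi, test_function L phi ->
    \int[leb3]_(x in Omega L) (u x * 'D_(basis3 i) phi x) =
    - \int[leb3]_(x in Omega L) (g x * phi x).

Definition H1 {R : realType} (L : R) (u : R * R * R -> R) : Prop :=
  L2 L u /\
  forall i : 'I_3, exists g, L2 L g /\ weak_derivative L i u g.

(** ** Grid functions *)

(* An N-periodic grid function is stored by its values on one period. *)
Definition grid (N : nat) (T : Type) := {ffun 'I_N * 'I_N * 'I_N -> T}.

Definition gridC {R : realType} {N : nat} (u : grid N R) : grid N R[i] :=
  [ffun p => (u p)%:C%C].

Definition gmap {T : Type} {N : nat} (g : T -> T) (u : grid N T) : grid N T :=
  [ffun p => g (u p)].

Definition gridh {R : realType} (L : R) (N : nat) : R := L / N%:R.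

Definition mu {R : realType} (L : R) : R := 2 * pi / L.

Definition node {R : realType} (L : R) {N : nat} (p : 'I_N * 'I_N * 'I_N) :
    R * R * R :=
  (p.1.1%:R * gridh L N, p.1.2%:R * gridh L N, p.2%:R * gridh L N).

(* Projection onto the grid: nodal values.  As H^1 functions on a
   three-dimensional domain need not be continuous, [u] is a pointwise defined
   representative; its values at the nodes (a null set, partly on the boundary
   of [Omega L]) are unconstrained by [H1 L u]. *)
Definition grid_proj {R : realType} (L : R) (N : nat) (u : R * R * R -> R) :
    grid N R :=
  [ffun p => u (node L p)].

(** ** Discrete Fourier transform and Fourier multipliers *)

(* The frequency -N/2 + i, so that 'I_N enumerates -N/2, ..., N/2 - 1 when N is
   even. *)
Definition freq {N : nat} (i : 'I_N) : int := i%:Z - (N./2)%:Z.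

Definition freqR {R : realType} {N : nat} (i : 'I_N) : R := (freq i)%:~R.

Definition cis {R : realType} (t : R) : R[i] := (cos t +i* sin t)%C.

Definition phase {R : realType} (L : R) {N : nat}
    (k p : 'I_N * 'I_N * 'I_N) : R :=
  mu L * (freqR k.1.1 * (node L p).1.1 + freqR k.1.2 * (node L p).1.2
          + freqR k.2 * (node L p).2).

Definition dft {R : realType} (L : R) {N : nat} (f : grid N R[i]) :
    grid N R[i] :=
  [ffun k => (N%:R ^+ 3)^-1 * \sum_p f p * cis (- phase L k p)].

Definition idft {R : realType} (L : R) {N : nat} (fh : grid N R[i]) :
    grid N R[i] :=
  [ffun p => \sum_k fh k * cis (phase L k p)].

Definition fmult {R : realType} (L : R) {N : nat}
    (s : 'I_N * 'I_N * 'I_N -> R[i]) (f : grid N R[i]) : grid N R[i] :=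
  idft L [ffun k => s k * dft L f k].

(* The grid functions [Dx f], [Dy f], [Dz f] need not be real when [f] is,
   because of the unpaired frequency -N/2. *)
Definition Dx {R : realType} (L : R) {N : nat} : grid N R[i] -> grid N R[i] :=
  fmult L (fun k => 'i%C * (mu L * freqR k.1.1)%:C%C).
Definition Dy {R : realType} (L : R) {N : nat} : grid N R[i] -> grid N R[i] :=
  fmult L (fun k => 'i%C * (mu L * freqR k.1.2)%:C%C).
Definition Dz {R : realType} (L : R) {N : nat} : grid N R[i] -> grid N R[i] :=
  fmult L (fun k => 'i%C * (mu L * freqR k.2)%:C%C).

Definition gradN {R : realType} (L : R) {N : nat} (f : grid N R[i]) :
    grid N R[i] * grid N R[i] * grid N R[i] :=
  (Dx L f, Dy L f, Dz L f).

Definition lapN {R : realType} (L : R) {N : nat} (f : grid N R[i]) :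
    grid N R[i] :=
  Dx L (Dx L f) + Dy L (Dy L f) + Dz L (Dz L f).

(** ** Inner product and norms *)

Definition inner {R : realType} (L : R) {N : nat} (f g : grid N R[i]) : R[i] :=
  (gridh L N ^+ 3)%:C%C * \sum_p f p * (g p)^*%C.

Definition norm2 {R : realType} (L : R) {N : nat} (f : grid N R[i]) : R :=
  Num.sqrt (complex.Re (inner L f f)).

Definition vnorm2 {R : realType} (L : R) {N : nat}
    (F : grid N R[i] * grid N R[i] * grid N R[i]) : R :=
  Num.sqrt (norm2 L F.1.1 ^+ 2 + norm2 L F.1.2 ^+ 2 + norm2 L F.2 ^+ 2).

Definition norm_oo {R : realType} {N : nat} (u : grid N R) : R :=
  \big[Num.max/0]_p `|u p|.

(** ** Nonlinearity, energy and the ERK2 scheme *)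

Definition Fpot {R : realType} (s : R) : R := (s ^+ 2 - 1) ^+ 2 / 4.

Definition fpot {R : realType} (s : R) : R := s ^+ 3 - s.

Definition energy {R : realType} (L eps : R) {N : nat} (u : grid N R) : R :=
  eps ^+ 2 / 2 * vnorm2 L (gradN L (gridC u)) ^+ 2
  + complex.Re (inner L (gridC (gmap Fpot u)) [ffun=> 1]).

Definition lambda {R : realType} (L : R) {N : nat} (k : 'I_N * 'I_N * 'I_N) :
    R :=
  mu L ^+ 2 * (freqR k.1.1 ^+ 2 + freqR k.1.2 ^+ 2 + freqR k.2 ^+ 2).

(* The eigenvalues of L_kappa = eps^2 lapN^2 - kappa lapN. *)
Definition Lambda {R : realType} (L eps kappa : R) {N : nat}
    (k : 'I_N * 'I_N * 'I_N) : R :=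
  eps ^+ 2 * lambda L k ^+ 2 + kappa * lambda L k.

Definition phi0 {R : realType} (z : R) : R := expR (- z).

Definition phi1 {R : realType} (z : R) : R :=
  if z == 0 then 1 else (1 - expR (- z)) / z.

(* The operator phi (tau L_kappa). *)
Definition phiL {R : realType} (L eps tau kappa : R) (phi : R -> R) {N : nat} :
    grid N R[i] -> grid N R[i] :=
  fmult L (fun k => (phi (tau * Lambda L eps kappa k))%:C%C).

Definition Nkappa {R : realType} (L kappa : R) {N : nat} (u : grid N R) :
    grid N R[i] :=
  lapN L (gridC (gmap fpot u)) - kappa%:C%C *: lapN L (gridC u).

Definition erk2_stage {R : realType} (L eps tau kappa : R) {N : nat}
    (u v : grid N R) : Prop :=
  gridC v = phiL L eps tau kappa phi0 (gridC u)
            + tau%:C%C *: phiL L eps tau kappa phi1 (Nkappa L kappa u).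

Definition erk2_update {R : realType} (L eps tau kappa : R) {N : nat}
    (u v w : grid N R) : Prop :=
  gridC w = phiL L eps tau kappa phi0 (gridC u)
            + (tau / 2)%:C%C *:
              phiL L eps tau kappa phi1 (Nkappa L kappa u + Nkappa L kappa v).

(* [u m] is the numerical solution at step m and [v m] is the intermediate
   stage between the steps m and m + 1. *)
Definition erk2_solution {R : realType} (L eps tau kappa : R) {N : nat}
    (u0 : grid N R) (u v : nat -> grid N R) : Prop :=
  u 0%N = u0 /\
  forall m, erk2_stage L eps tau kappa (u m) (v m) /\
            erk2_update L eps tau kappa (u m) (v m) (u m.+1).

(* Main.v *)
(* In Fourier space the energy increment between two grid functions bounded by M
   is at most a sum over the modes of quadratic forms, because
   F(y) - F(x) <= f(x) (y - x) + beta (y - x)^2 for |x|, |y| <= M.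
   With z = tau Lambda and p = phi1 z, the scheme expresses, mode by mode,
   eps^2 lambda u^n + f(u^n) and f(u_{n,1}) - f(u^n) in terms of the increments
   d = u_{n,1} - u^n and e = u^{n+1} - u_{n,1}.  The increment over the step,
   multiplied by tau lambda, becomes minus the form
     (1/p - c) d^2 + (1/p - z) d e + (2/p - c) e^2,
     c = z/2 + tau lambda (beta - kappa/2),
   which is nonnegative since 1/p >= 1 + z/2, 0 <= 1/p - z <= 1 and
   lambda <= 3 pi^2 / h^2. *)
Require Import Defs.
From mathcomp Require Import all_boot all_order all_algebra.
From mathcomp.real_closed Require Import complex.
From mathcomp Require Import all_classical all_reals all_analysis.
From mathcomp Require Import ring lra.
Import Order.TTheory GRing.Theory Num.Theory.
Import numFieldNormedType.Exports.
Local Open Scope ring_scope.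

(** * Quadratic forms of a single real mode *)

(* One real coordinate of one Fourier mode of the quadratic majorant of the
   energy increment, with [A] = eps^2 lambda and [d] the increment of [a]. *)
Definition mode_form (R : realFieldType) (A b a fa d : R) : R :=
  (A * a + fa) * d + (A / 2 + b) * d ^+ 2.

(** With [y = A * a + fa] the form is [- tau p l y^2] times [1 - p tau l (A/2 + b)]. The condition
    on [b] gives [tau l (A/2 + b) <= 1 + z/2] with [z = tau l (A + kappa)], so the last factor is
    nonnegative by the bound on [p]. *)
Lemma stage_mode_le0 (R : realFieldType) (tau p l A kappa b a fa d : R) :
  0 < tau -> 0 < l -> 0 < p -> (1 + tau * l * (A + kappa) / 2) * p <= 1 ->
  tau * l * (2 * b - kappa) <= 2 ->
  d = - (tau * p * l) * (A * a + fa) ->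
  mode_form R A b a fa d <= 0.
Proof.
move=> t0 l0 p0 hp hb ->; rewrite /mode_form.
set y := A * a + fa.
have -> : y * (- (tau * p * l) * y) + (A / 2 + b) * (- (tau * p * l) * y) ^+ 2 =
  - (tau * p * l * y ^+ 2) * (1 - p * (tau * l * (A / 2 + b))) by ring.
rewrite mulNr oppr_le0 mulr_ge0 //.
  by rewrite mulr_ge0 ?sqr_ge0 // ltW // !mulr_gt0.
rewrite subr_ge0 (le_trans _ hp) // [leRHS]mulrC ler_pM2l //; lra.
Qed.

Lemma update_mode_le0 (R : rcfType) (tau p l A kappa b a fa fv d e : R) :
  0 < tau -> 0 < l -> 0 < p ->
  let z := tau * l * (A + kappa) in
  (1 + z / 2) * p <= 1 -> z * p <= 1 -> 1 - z * p <= p ->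
  tau * l * (2 * b - kappa) <= 3 - Num.sqrt 2 ->
  d = - (tau * p * l) * (A * a + fa) ->
  e = tau / 2 * p * l * (kappa * d - (fv - fa)) ->
  mode_form R A b a fa d + mode_form R A b (a + d) fv e <= 0.
Proof.
move=> t0 l0 p0 z h1 h2 h3 hb dE eE; rewrite /mode_form.
have q0 : 0 < tau * l by rewrite mulr_gt0.
have tpl : tau * p * l != 0 by rewrite !mulf_neq0 // gt_eqF.
set c := tau * l * (A / 2 + b).
(* After multiplication by [p tau l] the two stage equations eliminate [fa] and [fv] without
   division, and a form in [d] and [e] alone is left. *)
rewrite -(pmulr_rle0 _ (mulr_gt0 p0 q0)).
have yE : tau * p * l * (A * a + fa) = - d by rewrite dE; ring.
have fE : tau * p * l * fv = tau * p * l * fa + tau * p * l * kappa * d - 2 * e.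
  by rewrite eE; field.
have -> : p * (tau * l) * ((A * a + fa) * d + (A / 2 + b) * d ^+ 2 +
    ((A * (a + d) + fv) * e + (A / 2 + b) * e ^+ 2)) =
   - ((1 - p * c) * d ^+ 2 + (1 - p * z) * (d * e) + (2 - p * c) * e ^+ 2).
  transitivity (tau * p * l * (A * a + fa) * d + p * c * d ^+ 2 +
    ((tau * p * l * A * (a + d) + tau * p * l * fv) * e + p * c * e ^+ 2)).
    by rewrite /c; ring.
  rewrite yE fE.
  transitivity (- d * d + p * c * d ^+ 2 + ((tau * p * l * (A * a + fa) +
    p * z * d - 2 * e) * e + p * c * e ^+ 2)); first by rewrite /z; ring.
  by rewrite yE; ring.
rewrite oppr_le0.
set r := Num.sqrt 2 in hb.
have r0 : 0 <= r by exact: sqrtr_ge0.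
have r2 : r ^+ 2 = 2 by rewrite sqr_sqrtr // ler0n.
have r1 : 1 < r by nra.
have cz : c <= z / 2 + (3 - r) / 2 by rewrite /c /z; lra.
have cp : p * c <= p * (z / 2 + (3 - r) / 2) by rewrite ler_pM2l.
(* With r = sqrt 2 the lower bounds p (r - 1) / 2 and p (r + 1) / 2 of the
   diagonal coefficients have product p^2 / 4, and the off-diagonal coefficient
   is at most p: this is where the constant 3 - sqrt 2 comes from. *)
have H1 : p * ((r - 1) / 2) <= 1 - p * c by lra.
have H2 : p * ((r + 1) / 2) <= 2 - p * c by lra.
have s0 : 0 <= 1 - p * z by lra.
have sp : 1 - p * z <= p by lra.
have : 0 <= p * ((r - 1) / 2 * d ^+ 2 + (r + 1) / 2 * e ^+ 2 - `|d * e|).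
  apply: mulr_ge0; first exact: ltW.
  (* Multiplied by [2 (r - 1)], the bracket equals this square, because
     [(r - 1) (r + 1) = r^2 - 1 = 1]. *)
  have sq : 0 <= ((r - 1) * `|d| - `|e|) ^+ 2 by exact: sqr_ge0.
  rewrite -(pmulr_rge0 _ (_ : 0 < 2 * (r - 1))); last by lra.
  rewrite normrM -(real_normK (num_real d)) -(real_normK (num_real e)).
  have -> : 2 * (r - 1) * ((r - 1) / 2 * `|d| ^+ 2 + (r + 1) / 2 * `|e| ^+ 2 -
    `|d| * `|e|) = (r - 1) ^+ 2 * `|d| ^+ 2 + (r ^+ 2 - 1) * `|e| ^+ 2 -
    2 * (r - 1) * (`|d| * `|e|) by field.
  rewrite r2; nra.
have : (1 - p * z) * (d * e) >= - (p * `|d * e|).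
  have : (1 - p * z) * - (d * e) <= p * `|d * e|.
    apply: (@le_trans _ _ ((1 - p * z) * `|d * e|)).
      by rewrite ler_wpM2l // -normrN ler_norm.
    exact: ler_wpM2r.
  lra.
have : (p * ((r - 1) / 2)) * d ^+ 2 <= (1 - p * c) * d ^+ 2 by rewrite ler_wpM2r ?sqr_ge0.
have : (p * ((r + 1) / 2)) * e ^+ 2 <= (2 - p * c) * e ^+ 2 by rewrite ler_wpM2r ?sqr_ge0.
lra.
Qed.

(** * Scalar inequalities for the potential and for [phi1] *)

(** A second-order Taylor bound: the coefficient is the maximum of [F''/2 = (3 s^2 - 1)/2] over
    [|s| <= M]. As [F] is quartic the remainder is explicit, and [2ab <= a^2 + b^2] bounds
    [b^2 + 2ab + 3a^2] by [6 M^2]. *)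
Lemma Fpot_le (R : realType) (M a b : R) : `|a| <= M -> `|b| <= M ->
  Fpot b - Fpot a <= fpot a * (b - a) + (3 * M ^+ 2 - 1) / 2 * (b - a) ^+ 2.
Proof.
move=> aM bM.
have a2 : a ^+ 2 <= M ^+ 2 by rewrite -real_normK ?num_real// ler_sqr ?nnegrE // (le_trans _ aM).
have b2 : b ^+ 2 <= M ^+ 2 by rewrite -real_normK ?num_real// ler_sqr ?nnegrE // (le_trans _ aM).
rewrite -subr_ge0 /Fpot /fpot.
have -> : (a ^+ 3 - a) * (b - a) + (3 * M ^+ 2 - 1) / 2 * (b - a) ^+ 2 -
   ((b ^+ 2 - 1) ^+ 2 / 4 - (a ^+ 2 - 1) ^+ 2 / 4) =
   (b - a) ^+ 2 * (6 * M ^+ 2 - (b ^+ 2 + 2 * a * b + 3 * a ^+ 2)) / 4 by field.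
apply: mulr_ge0; last by rewrite invr_ge0 ler0n.
apply: mulr_ge0; first exact: sqr_ge0.
have := sqr_ge0 (a - b); rewrite sqrrB mulr2n; lra.
Qed.

(** The Padé lower bound [(1 - z/2)/(1 + z/2)] for [exp(-z)], with the denominator cleared. The
    function [f] equals 1 at 0, and its derivative [df] is nonnegative on [[0, z]] because
    [exp x >= 1 + x]. *)
Lemma expRN_pade_ge (R : realType) (z : R) : 0 <= z ->
  1 - z / 2 <= (1 + z / 2) * expR (- z).
Proof.
move=> z0.
pose f (x : R) := (1 + x / 2) * expR (- x) + x / 2.
pose df (x : R) := (1 - (1 + x) * expR (- x)) / 2.
have fD (x : R) : is_derive x (1 : R) f (df x).
  rewrite /f /df; apply: is_derive_eq.
  rewrite /GRing.scale /=; by field.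
have cf : {within `[0, z], continuous f}%classic.
  by apply: continuous_subspaceT => x; apply/differentiable_continuous/derivable1_diffP; apply: ex_derive.
have [c /[!in_itv]/= /andP[c0 _]] := MVT_segment z0 (fun x _ => fD x) cf.
have : 0 <= df c * (z - 0).
  rewrite subr0 mulr_ge0 // divr_ge0 // expRN subr_ge0 ler_pdivrMr ?expR_gt0 // mul1r.
  exact: expR_ge1Dx.
by rewrite /f oppr0 expR0 => + fE; rewrite -fE; lra.
Qed.

(** Since [1 - z * phi1 z = exp(-z)], the third bound is positivity of the exponential, the fourth
    amounts to [(1 + z) exp(-z) <= 1], and the second is the Padé bound. *)
Lemma phi1_bounds (R : realType) (z : R) : 0 < z ->
  [/\ 0 < phi1 z, (1 + z / 2) * phi1 z <= 1, z * phi1 z <= 1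
    & 1 - z * phi1 z <= phi1 z].
Proof.
move=> z0; rewrite /phi1 gt_eqF //.
have e0 := expR_gt0 (- z).
have e1 : expR (- z) < 1 by rewrite expR_lt1 oppr_lt0.
have zE : z * ((1 - expR (- z)) / z) = 1 - expR (- z) by rewrite mulrC divfK // gt_eqF.
rewrite zE; split.
- by rewrite divr_gt0 // subr_gt0.
- rewrite mulrA ler_pdivrMr // mul1r.
  by have := @expRN_pade_ge R z (ltW z0); lra.
- lra.
- rewrite ler_pdivlMr // opprB addrCA subrr addr0.
  have : (1 + z) * expR (- z) <= 1.
    by rewrite expRN ler_pdivrMr ?expR_gt0 // mul1r expR_ge1Dx.
  by lra.
Qed.

(** * Orthogonality of the discrete characters *)

Lemma cis0 (R : realType) : cis 0 = 1 :> R[i].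
Proof. by rewrite /cis cos0 sin0. Qed.

Lemma cisD (R : realType) (a b : R) : cis (a + b) = cis a * cis b.
Proof. by rewrite /cis cosD sinD [X in (_ +i* X)%C]addrC. Qed.

Lemma conj_cis (R : realType) (a : R) : (cis a)^*%C = cis (- a).
Proof. by rewrite /cis cosN sinN. Qed.

Lemma cis_2pi_nat (R : realType) (n : nat) : cis (2 * pi * n%:R) = 1 :> R[i].
Proof.
elim: n => [|n IH]; first by rewrite mulr0 cis0.
rewrite -[n.+1%:R]natr1 mulrDr cisD IH mul1r mulr1 mulr_natl /cis cos2pi.
by rewrite sin_mulr2n cospi sinpi mulr0 mul0rn.
Qed.

(** Conjugation reduces to [t > 0]. There the real part is already different from 1:
    [cos t = 1 - 2 sin^2(t/2)] and [0 < t/2 < pi]. *)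
Lemma cis_neq1 (R : realType) (t : R) : 0 < `|t| < 2 * pi -> cis t != 1.
Proof.
wlog t0 : t / 0 <= t => [hw tb|].
  have [t0|t0] := leP 0 t; first exact: hw.
  have := hw (- t); rewrite normrN oppr_ge0 => /(_ (ltW t0) tb).
  by apply: contraNN => /eqP c1; rewrite -conj_cis c1 conjc1.
rewrite ger0_norm // => /andP[tp t2].
rewrite eq_complex /= negb_and; apply/orP; left.
have -> : t = (t / 2) *+ 2 by rewrite mulr2n; lra.
rewrite cos_mulr2n cos2sin2 lt_eqF //.
have : 0 < sin (t / 2) ^+ 2 by rewrite exprn_gt0 // sin_gt0_pi //; lra.
rewrite mulr2n; lra.
Qed.

(** A geometric sum of ratio [cis t], an [N]-th root of unity different from 1 when [p] and [q]
    differ: multiplied by [cis t - 1] it telescopes to 0. The offset [b] lets the lemma serve sums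
    over frequencies, whose range starts at [-N/2], as well as sums over nodes. *)
Lemma sum_cis_orth (R : realType) (N : nat) (p q : 'I_N) (b : R) :
  \sum_(i < N) cis (b + 2 * pi / N%:R * (p%:R - q%:R) * i%:R) =
  (p == q)%:R * N%:R * cis b.
Proof.
have [->|pq] := eqVneq p q.
  under eq_bigr do rewrite subrr mulr0 mul0r addr0.
  by rewrite sumr_const card_ord mul1r mulr_natl.
rewrite !mul0r; set t := _ * (_ - _).
have N0 : 0 < N%:R :> R by rewrite ltr0n (leq_ltn_trans _ (ltn_ord p)).
have dpos : 0 < `|p%:R - q%:R : R| < N%:R.
  rewrite normr_gt0 subr_eq0 eqr_nat pq /= ltr_norml ltrBlDr ltrBrDr.
  rewrite -natrD [X in _ && X]ltr_nat.
  have : p%:R < N%:R :> R by rewrite ltr_nat.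
  have : q%:R < N%:R :> R by rewrite ltr_nat.
  have : 0 <= p%:R :> R by [].
  by move=> *; apply/andP; split; [lra | rewrite ltn_addr].
have c1 : cis t - 1 != 0.
  rewrite subr_eq0; apply: cis_neq1; rewrite /t normrM.
  have c0 : 0 < 2 * pi / N%:R :> R by rewrite divr_gt0 // mulr_gt0 // pi_gt0.
  rewrite (gtr0_norm c0); case/andP: dpos => d0 dN.
  rewrite mulr_gt0 //= -ltr_pdivlMl //; congr (_ < _): dN.
  by rewrite invf_div divfK // gt_eqF // mulr_gt0 // pi_gt0.
apply: (mulfI c1); rewrite mulr0 mulr_sumr.
transitivity (\sum_(0 <= i < N) (cis (b + t * i.+1%:R) - cis (b + t * i%:R))).
  rewrite big_mkord; apply: eq_bigr => i _.
  by rewrite -natr1 mulrDr mulr1 addrA [cis (_ + t)]cisD mulrBl mul1r mulrC.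
rewrite (telescope_sumr (fun i => cis (b + t * i%:R))) // mulr0 addr0.
have -> : t * N%:R = 2 * pi * p%:R - 2 * pi * q%:R.
  by rewrite /t; field; rewrite gt_eqF.
by rewrite cisD [cis (_ - _)]cisD -conj_cis !cis_2pi_nat conjc1 !mulr1 subrr.
Qed.

Lemma sum_triple (A : comNzRingType) (I : finType) (F G H : I -> A) :
  \sum_(p : I * I * I) F p.1.1 * G p.1.2 * H p.2 =
  (\sum_i F i) * (\sum_i G i) * (\sum_i H i).
Proof.
rewrite -(pair_bigA _ (fun q k => F q.1 * G q.2 * H k)) /=.
under eq_bigr do rewrite -mulr_sumr.
rewrite -mulr_suml; congr (_ * _).
rewrite -(pair_bigA _ (fun i j => F i * G j)) /= mulr_suml.
by apply: eq_bigr => i _; rewrite mulr_sumr.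
Qed.

Lemma triple_eqE (I : eqType) (p q : I * I * I) :
  (p == q) = [&& p.1.1 == q.1.1, p.1.2 == q.1.2 & p.2 == q.2].
Proof. by case: p => [[? ?] ?]; case: q => [[? ?] ?]; rewrite !xpair_eqE andbA. Qed.

Lemma phaseE (R : realType) (L : R) (N : nat) (k p : 'I_N * 'I_N * 'I_N) : L != 0 ->
  phase L k p = 2 * pi / N%:R * (k.1.1%:R - (N./2)%:R) * p.1.1%:R +
    2 * pi / N%:R * (k.1.2%:R - (N./2)%:R) * p.1.2%:R +
    2 * pi / N%:R * (k.2%:R - (N./2)%:R) * p.2%:R.
Proof.
move=> L0; have N0 : N%:R != 0 :> R.
  by rewrite pnatr_eq0 -lt0n (leq_ltn_trans _ (ltn_ord p.2)).
rewrite /phase /node /gridh /mu /freqR /freq /= !rmorphB /= -!pmulrn.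
by move: pi => P; field; rewrite L0 N0.
Qed.

Lemma sum_cis_phase_grid (R : realType) (L : R) (N : nat)
    (k k' : 'I_N * 'I_N * 'I_N) : L != 0 ->
  \sum_p cis (phase L k p - phase L k' p) = (k == k')%:R * N%:R ^+ 3.
Proof.
move=> L0; rewrite triple_eqE.
pose E (i j l : 'I_N) : R[i] := cis (0 + 2 * pi / N%:R * (i%:R - j%:R) * l%:R).
transitivity (\sum_p E k.1.1 k'.1.1 p.1.1 * E k.1.2 k'.1.2 p.1.2 * E k.2 k'.2 p.2).
  apply: eq_bigr => p _; rewrite /E -!cisD !phaseE //.
  by congr cis; move: pi => P; ring.
rewrite sum_triple !sum_cis_orth cis0 !mulr1.
by do 3 case: eqP => _; rewrite /= ?mul1r ?mul0r ?mulr0 ?mul0r // exprSr expr2.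
Qed.

Lemma sum_cis_phase_freq (R : realType) (L : R) (N : nat)
    (p p' : 'I_N * 'I_N * 'I_N) : L != 0 ->
  \sum_k cis (phase L k p - phase L k p') = (p == p')%:R * N%:R ^+ 3.
Proof.
move=> L0; rewrite triple_eqE.
(* In a sum over frequencies the starting point [-N/2] leaves a constant phase in each direction,
   which vanishes when the two node indices agree. *)
pose w (i j : 'I_N) : R := - (2 * pi / N%:R * (i%:R - j%:R) * (N./2)%:R).
pose E (i j l : 'I_N) : R[i] :=
  cis (w i j + 2 * pi / N%:R * (i%:R - j%:R) * l%:R).
transitivity (\sum_k E p.1.1 p'.1.1 k.1.1 * E p.1.2 p'.1.2 k.1.2 * E p.2 p'.2 k.2).
  apply: eq_bigr => k _; rewrite /E -!cisD !phaseE //.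
  by congr cis; rewrite /w; move: pi => P; ring.
have w0 i : cis (w i i) = 1 by rewrite /w subrr mulr0 mul0r oppr0 cis0.
rewrite sum_triple !sum_cis_orth.
by do 3 case: eqP => [->|_]; rewrite /= ?w0 ?mulr1 ?mul1r ?mul0r ?mulr0 ?mul0r // exprSr expr2.
Qed.

(** * Fourier inversion, multipliers and Parseval's identity *)

Lemma dftK (R : realType) (L : R) (N : nat) (f : grid N R[i]) : L != 0 ->
  idft L (dft L f) = f.
Proof.
move=> L0; apply/ffunP => p; rewrite !ffunE.
have N0 : N%:R != 0 :> R[i].
  by rewrite pnatr_eq0 -lt0n (leq_ltn_trans _ (ltn_ord p.2)).
under eq_bigr => k _ do rewrite ffunE -mulrA mulr_suml.
rewrite -mulr_sumr exchange_big /=.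
under eq_bigr => q _.
  under eq_bigr => k _ do rewrite -mulrA -cisD addrC.
  rewrite -mulr_sumr sum_cis_phase_freq //.
  over.
rewrite (bigD1 p) //= eqxx mul1r big1 => [|q /negbTE qp].
  by rewrite addr0 mulrC mulfK // expf_neq0.
by rewrite eq_sym qp mul0r mulr0.
Qed.

Lemma idftK (R : realType) (L : R) (N : nat) (f : grid N R[i]) : L != 0 ->
  dft L (idft L f) = f.
Proof.
move=> L0; apply/ffunP => k; rewrite !ffunE.
have N0 : N%:R != 0 :> R[i].
  by rewrite pnatr_eq0 -lt0n (leq_ltn_trans _ (ltn_ord k.2)).
under eq_bigr => p _ do rewrite ffunE mulr_suml.
rewrite exchange_big /=.
under eq_bigr => q _.
  under eq_bigr => p _ do rewrite -mulrA -cisD.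
  rewrite -mulr_sumr sum_cis_phase_grid //.
  over.
rewrite (bigD1 k) //= eqxx mul1r big1 => [|q /negbTE ->].
  by rewrite addr0 mulrC mulfK // expf_neq0.
by rewrite mul0r mulr0.
Qed.

Lemma dft_fmult (R : realType) (L : R) (N : nat) s (f : grid N R[i]) k :
  L != 0 -> dft L (fmult L s f) k = s k * dft L f k.
Proof. by move=> L0; rewrite /fmult idftK // ffunE. Qed.

Lemma dftD (R : realType) (L : R) (N : nat) (f g : grid N R[i]) k :
  dft L (f + g) k = dft L f k + dft L g k.
Proof.
rewrite !ffunE -mulrDr -big_split /=; congr (_ * _).
by apply: eq_bigr => p _; rewrite ffunE mulrDl.
Qed.

Lemma dftZ (R : realType) (L : R) (N : nat) (c : R[i]) (f : grid N R[i]) k :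
  dft L (c *: f) k = c * dft L f k.
Proof.
rewrite !ffunE mulrCA; congr (_ * _); rewrite mulr_sumr.
by apply: eq_bigr => p _; rewrite ffunE mulrA.
Qed.

Lemma dftB (R : realType) (L : R) (N : nat) (f g : grid N R[i]) k :
  dft L (f - g) k = dft L f k - dft L g k.
Proof. by rewrite -scaleN1r dftD dftZ mulN1r. Qed.

Lemma dft_lapN (R : realType) (L : R) (N : nat) (f : grid N R[i]) k : L != 0 ->
  dft L (lapN L f) k = - (lambda L k)%:C%C * dft L f k.
Proof.
move=> L0; rewrite /lapN !dftD !dft_fmult // !mulrA -!mulrDl; congr (_ * _).
rewrite /lambda !(rmorphM, rmorphD, rmorphXn) /=.
have := sqr_i R; move: (_ *i)%C => I I2.
ring: I2.
Qed.

Lemma conjcM (R : rcfType) (x y : R[i]) : (x * y)^*%C = x^*%C * y^*%C.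
Proof. exact: rmorphM. Qed.

Lemma conjc_sum (R : rcfType) (I : finType) (F : I -> R[i]) :
  (\sum_i F i)^*%C = \sum_i (F i)^*%C.
Proof. exact: rmorph_sum. Qed.

(** Parseval's identity. Only [g] is expanded by Fourier inversion; after exchanging the sums, the
    sum over nodes is [N^3] times the transform of [f], and [h^3 N^3 = L^3]. *)
Lemma inner_dft (R : realType) (L : R) (N : nat) (f g : grid N R[i]) : L != 0 ->
  (0 < N)%N ->
  inner L f g = (L ^+ 3)%:C%C * \sum_k dft L f k * (dft L g k)^*%C.
Proof.
move=> L0 N0; have N1 : N%:R != 0 :> R[i] by rewrite pnatr_eq0 -lt0n.
rewrite /inner -{1}(dftK R L N g L0).
under eq_bigr => p _.
  rewrite ffunE conjc_sum mulr_sumr.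
  under eq_bigr => k _ do rewrite conjcM conj_cis mulrCA.
  over.
rewrite exchange_big /=.
under eq_bigr => k _.
  rewrite -mulr_sumr.
  have -> : \sum_p f p * cis (- phase L k p) = N%:R ^+ 3 * dft L f k.
    by rewrite ffunE mulrA mulfV ?mul1r // expf_neq0.
  rewrite mulrCA.
  over.
rewrite -mulr_sumr mulrA; congr (_ * _).
  have -> : N%:R ^+ 3 = (N%:R ^+ 3)%:C%C :> R[i] by rewrite rmorphXn rmorph_nat.
  by rewrite /gridh -rmorphM /= -exprMn divfK // pnatr_eq0 -lt0n.
by apply: eq_bigr => k _; rewrite mulrC.
Qed.

(** * Real and imaginary parts, and the energy in Fourier space *)

Lemma ReD (R : rcfType) (x y : R[i]) :
  complex.Re (x + y) = complex.Re x + complex.Re y.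
Proof. by case: x y => ? ? [? ?]. Qed.

Lemma ImD (R : rcfType) (x y : R[i]) :
  complex.Im (x + y) = complex.Im x + complex.Im y.
Proof. by case: x y => ? ? [? ?]. Qed.

Lemma ReB (R : rcfType) (x y : R[i]) :
  complex.Re (x - y) = complex.Re x - complex.Re y.
Proof. by case: x y => ? ? [? ?]. Qed.

Lemma ImB (R : rcfType) (x y : R[i]) :
  complex.Im (x - y) = complex.Im x - complex.Im y.
Proof. by case: x y => ? ? [? ?]. Qed.

Lemma ReZ (R : rcfType) (x : R) (y : R[i]) :
  complex.Re (x%:C%C * y) = x * complex.Re y.
Proof. by case: y => ? ?; rewrite /= mul0r subr0. Qed.

Lemma ImZ (R : rcfType) (x : R) (y : R[i]) :
  complex.Im (x%:C%C * y) = x * complex.Im y.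
Proof. by case: y => ? ?; rewrite /= mul0r addr0. Qed.

Lemma Re_mulJ (R : rcfType) (x y : R[i]) : complex.Re (x * y^*%C) =
  complex.Re x * complex.Re y + complex.Im x * complex.Im y.
Proof. by case: x y => ? ? [? ?]; rewrite /= mulrN opprK. Qed.

Lemma Re_sum (R : rcfType) (I : finType) (F : I -> R[i]) :
  complex.Re (\sum_i F i) = \sum_i complex.Re (F i).
Proof. exact: (big_morph _ (@ReD R)). Qed.

Lemma Re_inner_dft (R : realType) (L : R) (N : nat) (f g : grid N R[i]) :
  L != 0 -> (0 < N)%N ->
  complex.Re (inner L f g) = L ^+ 3 * \sum_k
    (complex.Re (dft L f k) * complex.Re (dft L g k) +
     complex.Im (dft L f k) * complex.Im (dft L g k)).
Proof.
move=> L0 N0; rewrite inner_dft // ReZ Re_sum.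
by under eq_bigr do rewrite Re_mulJ.
Qed.

Lemma Re_inner_gridC (R : realType) (L : R) (N : nat) (u w : grid N R) :
  complex.Re (inner L (gridC u) (gridC w)) = gridh L N ^+ 3 * \sum_p u p * w p.
Proof.
rewrite /inner ReZ Re_sum; congr (_ * _); apply: eq_bigr => p _.
by rewrite Re_mulJ !ffunE /= mulr0 addr0.
Qed.

Lemma norm2_sqr (R : realType) (L : R) (N : nat) (f : grid N R[i]) :
  0 < L -> norm2 L f ^+ 2 = complex.Re (inner L f f).
Proof.
move=> L0; rewrite /norm2 sqr_sqrtr // /inner ReZ Re_sum mulr_ge0 //.
  by rewrite exprn_ge0 // divr_ge0 // ltW.
by apply: sumr_ge0 => p _; rewrite Re_mulJ addr_ge0 // -expr2 sqr_ge0.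
Qed.

Lemma vnorm2_gradN (R : realType) (L : R) (N : nat) (f : grid N R[i]) :
  0 < L -> (0 < N)%N ->
  vnorm2 L (gradN L f) ^+ 2 = L ^+ 3 * \sum_k
    lambda L k * (complex.Re (dft L f k) ^+ 2 + complex.Im (dft L f k) ^+ 2).
Proof.
move=> L0 N0; have L1 : L != 0 by rewrite gt_eqF.
have sqI (x : R) (z : R[i]) :
    complex.Re ('i%C * x%:C%C * z) * complex.Re ('i%C * x%:C%C * z) +
    complex.Im ('i%C * x%:C%C * z) * complex.Im ('i%C * x%:C%C * z) =
    x ^+ 2 * (complex.Re z ^+ 2 + complex.Im z ^+ 2).
  by case: z => s t /=; ring.
rewrite /vnorm2 sqr_sqrtr; last by rewrite !addr_ge0 // sqr_ge0.
rewrite !norm2_sqr // !Re_inner_dft // -!mulrDr -!big_split /=; congr (_ * _).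
apply: eq_bigr => k _; rewrite !dft_fmult // !sqI /lambda; ring.
Qed.

Lemma energyE (R : realType) (L eps : R) (N : nat) (u : grid N R) :
  0 < L -> (0 < N)%N ->
  energy L eps u = L ^+ 3 * (\sum_k eps ^+ 2 * lambda L k / 2 *
    (complex.Re (dft L (gridC u) k) ^+ 2 + complex.Im (dft L (gridC u) k) ^+ 2))
    + gridh L N ^+ 3 * \sum_p Fpot (u p).
Proof.
move=> L0 N0; rewrite /energy vnorm2_gradN //; congr (_ + _).
  rewrite mulrCA; congr (_ * _); rewrite mulr_sumr; apply: eq_bigr => k _.
  by rewrite mulrA; congr (_ * _); rewrite mulrAC.
rewrite /inner ReZ Re_sum; congr (_ * _); apply: eq_bigr => p _.
by rewrite !ffunE conjc1 mulr1.
Qed.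

(** The multipliers in the energy and in the scheme's mode equations are real, so the real and
    imaginary parts of a mode evolve by the same relations and the real form applies to each. *)
Definition cmode_form (R : rcfType) (A b : R) (a fa d : R[i]) : R :=
  mode_form R A b (complex.Re a) (complex.Re fa) (complex.Re d) +
  mode_form R A b (complex.Im a) (complex.Im fa) (complex.Im d).

Lemma norm_oo_ge (R : realType) (N : nat) (u : grid N R) p : `|u p| <= norm_oo u.
Proof. exact: le_bigmax. Qed.

Lemma energy_diff_le (R : realType) (L eps M : R) (N : nat) (u w : grid N R) :
  0 < L -> (0 < N)%N -> norm_oo u <= M -> norm_oo w <= M ->
  energy L eps w - energy L eps u <= L ^+ 3 * \sum_k
    cmode_form R (eps ^+ 2 * lambda L k) ((3 * M ^+ 2 - 1) / 2)
      (dft L (gridC u) k) (dft L (gridC (gmap fpot u)) k)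
      (dft L (gridC w) k - dft L (gridC u) k).
Proof.
move=> L0 N0 uM wM; rewrite !energyE //.
have L1 : L != 0 by rewrite gt_eqF.
set b := (3 * M ^+ 2 - 1) / 2.
set X := \sum_k _ => /=; set Y := \sum_p _; set X' := \sum_k _; set Y' := \sum_p _.
have gridCB (x y : grid N R) : gridC (x - y) = gridC x - gridC y.
  by apply/ffunP => p; rewrite !ffunE rmorphB.
have hY : gridh L N ^+ 3 * Y - gridh L N ^+ 3 * Y' <=
    complex.Re (inner L (gridC (gmap fpot u)) (gridC (w - u))) +
    b * complex.Re (inner L (gridC (w - u)) (gridC (w - u))).
  rewrite !Re_inner_gridC mulrCA -mulrDr -mulrBr ler_wpM2l //.
    by rewrite exprn_ge0 // divr_ge0 // ltW.
  rewrite -sumrB mulr_sumr -big_split /=; apply: ler_sum => p _.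
  rewrite !ffunE -expr2; apply: Fpot_le.
    by rewrite (le_trans (norm_oo_ge R N u p)).
  by rewrite (le_trans (norm_oo_ge R N w p)).
rewrite !Re_inner_dft // gridCB in hY.
rewrite opprD addrACA; apply: (le_trans (lerD (lexx _) hY)).
rewrite [b * _]mulrCA -mulrBr -!mulrDr ler_wpM2l //; first by rewrite exprn_ge0 // ltW.
rewrite -sumrB mulr_sumr -!big_split /=; apply: ler_sum => k _.
rewrite !dftB /cmode_form /mode_form !ReB !ImB.
by rewrite le_eqVlt; apply/orP; left; apply/eqP; field.
Qed.

(** * Bounds on the eigenvalues of the discrete Laplacian *)

Lemma freqR_sqr_le (R : realType) (N : nat) (i : 'I_N) : ~~ odd N ->
  (freqR i : R) ^+ 2 <= N%:R ^+ 2 / 4.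
Proof.
move=> Ne; have NE : N%:R = 2 * (N./2)%:R :> R.
  by rewrite -[in LHS](odd_double_half N) (negbTE Ne) add0n -mul2n natrM.
have : i%:R <= N%:R :> R by rewrite ler_nat ltnW.
have : 0 <= i%:R :> R by [].
rewrite NE /freqR /freq rmorphB /= -!pmulrn => i0 iN.
nra.
Qed.

Lemma lambda_ge0 (R : realType) (L : R) (N : nat) (k : 'I_N * 'I_N * 'I_N) :
  0 <= lambda L k.
Proof. by rewrite /lambda mulr_ge0 ?sqr_ge0 // !addr_ge0 // sqr_ge0. Qed.

(** Here [h^2 lambda] is [4 pi^2 / N^2] times a sum of three squared frequencies, each at most
    [N^2 / 4]. This is the source of [3 pi^2] in the condition on [kappa]. *)
Lemma lambda_le (R : realType) (L : R) (N : nat) (k : 'I_N * 'I_N * 'I_N) :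
  0 < L -> ~~ odd N ->
  gridh L N ^+ 2 * lambda L k <= 3 * pi ^+ 2.
Proof.
move=> L0 Ne.
have N0 : 0 < N%:R :> R by rewrite ltr0n (leq_ltn_trans _ (ltn_ord k.2)).
have -> : gridh L N ^+ 2 * lambda L k = 4 * pi ^+ 2 / N%:R ^+ 2 *
   (freqR k.1.1 ^+ 2 + freqR k.1.2 ^+ 2 + freqR k.2 ^+ 2).
  by rewrite /lambda /gridh /mu; move: pi => P; field; rewrite !gt_eqF.
have -> : 3 * pi ^+ 2 = 4 * pi ^+ 2 / N%:R ^+ 2 * (N%:R ^+ 2 / 4 * 3) :> R.
  by move: pi => P; field; rewrite gt_eqF.
rewrite ler_wpM2l //; first by rewrite divr_ge0 ?sqr_ge0 // mulr_ge0 ?sqr_ge0.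
have := freqR_sqr_le R N k.1.1 Ne; have := freqR_sqr_le R N k.1.2 Ne.
have := freqR_sqr_le R N k.2 Ne; lra.
Qed.

(** * The ERK2 scheme mode by mode *)

(** Eliminates the exponential, so that each mode of the scheme becomes an algebraic relation in
    [phi1] alone. *)
Lemma phi0E (R : realType) (z : R) : phi0 z = 1 - z * phi1 z.
Proof.
rewrite /phi0 /phi1; case: eqP => [->|/eqP z0]; first by rewrite oppr0 expR0 mul0r subr0.
by rewrite mulrC divfK // subKr.
Qed.

Lemma dft_Nkappa (R : realType) (L kappa : R) (N : nat) (u : grid N R) k :
  L != 0 -> dft L (Nkappa L kappa u) k = (lambda L k)%:C%C *
    (kappa%:C%C * dft L (gridC u) k - dft L (gridC (gmap fpot u)) k).
Proof.
move=> L0; rewrite /Nkappa; move: (gridC u) (gridC (gmap fpot u)) => U F.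
rewrite dftB dftZ.
have := dft_lapN R L N F k L0; have := dft_lapN R L N U k L0.
move: (lapN L F) (lapN L U) => F' U' -> ->.
move: (dft L U k) (dft L F k) (_ %:C)%C (_ %:C)%C => *; ring.
Qed.

Lemma dft_phiL (R : realType) (L eps tau kappa : R) (N : nat) (c : R[i])
    (f g : grid N R[i]) k (z := tau * Lambda L eps kappa k) : L != 0 ->
  dft L (phiL L eps tau kappa phi0 f + c *: phiL L eps tau kappa phi1 g) k =
  (phi0 z)%:C%C * dft L f k + c * ((phi1 z)%:C%C * dft L g k).
Proof.
move=> L0; have := dft_fmult R L N (fun k => (phi0 (tau * Lambda L eps kappa k))%:C%C) f k L0.
have := dft_fmult R L N (fun k => (phi1 (tau * Lambda L eps kappa k))%:C%C) g k L0.
rewrite /phiL -/z; move: (fmult L _ f) (fmult L _ g) => f' g' <- <-.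
by rewrite dftD dftZ.
Qed.

(** With [phi0 = 1 - z phi1] and [z = tau lambda (eps^2 lambda + kappa)], the [kappa] part of [z]
    cancels the stabilizing term of [Nkappa]. *)
Lemma dft_stage (R : realType) (L eps tau kappa : R) (N : nat)
    (u v : grid N R) k : L != 0 -> erk2_stage L eps tau kappa u v ->
  dft L (gridC v) k - dft L (gridC u) k =
    (- (tau * phi1 (tau * Lambda L eps kappa k) * lambda L k))%:C%C *
    ((eps ^+ 2 * lambda L k)%:C%C * dft L (gridC u) k
     + dft L (gridC (gmap fpot u)) k).
Proof.
move=> L0 hv.
have := etrans (congr1 (fun f : grid N R[i] => dft L f k) hv)
  (dft_phiL R L eps tau kappa N _ _ _ k L0).
have := dft_Nkappa R L kappa N u k L0.
move: (dft L (Nkappa L kappa u) k) (dft L (gridC v) k) => y' x' -> ->.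
rewrite phi0E; set p := phi1 _; rewrite /Lambda; move: p (lambda L k) => p l.
move: (dft L (gridC u) k) (dft L (gridC (gmap fpot u)) k) => x y.
rewrite rmorphN rmorphB rmorph1 !(rmorphM, rmorphD, rmorphXn) /=.
ring.
Qed.

(* The term q * x, common to both stages, cancels. *)
Lemma update_mode_increment (R : rcfType) (tau kappa p q l : R)
    (x y w nu nv s fu fv : R[i]) :
  nu = l%:C%C * (kappa%:C%C * x - fu) -> nv = l%:C%C * (kappa%:C%C * y - fv) ->
  s = nu + nv ->
  y = q%:C%C * x + tau%:C%C * (p%:C%C * nu) ->
  w = q%:C%C * x + (tau / 2)%:C%C * (p%:C%C * s) ->
  w - y = (tau / 2 * p * l)%:C%C * (kappa%:C%C * (y - x) - (fv - fu)).
Proof.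
move=> nuE nvE -> yE ->; rewrite {1}yE nuE nvE.
have -> : (tau%:C = (tau / 2)%:C + (tau / 2)%:C)%C by rewrite -rmorphD -splitr.
by rewrite !rmorphM /=; move: (_ %:C)%C (_ %:C)%C => *; ring.
Qed.

Lemma dft_update (R : realType) (L eps tau kappa : R) (N : nat)
    (u v w : grid N R) k : L != 0 -> erk2_stage L eps tau kappa u v ->
  erk2_update L eps tau kappa u v w ->
  dft L (gridC w) k - dft L (gridC v) k =
    (tau / 2 * phi1 (tau * Lambda L eps kappa k) * lambda L k)%:C%C *
    (kappa%:C%C * (dft L (gridC v) k - dft L (gridC u) k)
     - (dft L (gridC (gmap fpot v)) k - dft L (gridC (gmap fpot u)) k)).
Proof.
move=> L0 hv hw.
have vE := etrans (congr1 (fun f : grid N R[i] => dft L f k) hv)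
  (dft_phiL R L eps tau kappa N _ _ _ k L0).
have wE := etrans (congr1 (fun f : grid N R[i] => dft L f k) hw)
  (dft_phiL R L eps tau kappa N _ _ _ k L0).
exact: (update_mode_increment R _ _ _ _ _ _ _ _ _ _ _ _ _
  (dft_Nkappa R L kappa N u k L0) (dft_Nkappa R L kappa N v k L0)
  (dftD R L N _ _ k) vE wE).
Qed.

(** * Sign of the complex forms and energy decay *)

Lemma cmode_form_stage_le0 (R : rcfType) (tau p l A kappa b : R) (a fa d : R[i]) :
  0 < tau -> 0 < l -> 0 < p -> (1 + tau * l * (A + kappa) / 2) * p <= 1 ->
  tau * l * (2 * b - kappa) <= 2 ->
  d = (- (tau * p * l))%:C%C * (A%:C%C * a + fa) ->
  cmode_form R A b a fa d <= 0.
Proof.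
move=> t0 l0 p0 h1 hb dE; rewrite /cmode_form -[leRHS]addr0 lerD //.
  by apply: (stage_mode_le0 _ tau p l _ kappa) => //; rewrite dE ReZ ReD ReZ.
by apply: (stage_mode_le0 _ tau p l _ kappa) => //; rewrite dE ImZ ImD ImZ.
Qed.

Lemma cmode_form_update_le0 (R : rcfType) (tau p l A kappa b : R)
    (a fa fv d e : R[i]) :
  0 < tau -> 0 < l -> 0 < p ->
  let z := tau * l * (A + kappa) in
  (1 + z / 2) * p <= 1 -> z * p <= 1 -> 1 - z * p <= p ->
  tau * l * (2 * b - kappa) <= 3 - Num.sqrt 2 ->
  d = (- (tau * p * l))%:C%C * (A%:C%C * a + fa) ->
  e = (tau / 2 * p * l)%:C%C * (kappa%:C%C * d - (fv - fa)) ->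
  cmode_form R A b a fa d + cmode_form R A b (a + d) fv e <= 0.
Proof.
move=> t0 l0 p0 z h1 h2 h3 hb dE eE.
rewrite /cmode_form addrACA -[leRHS]addr0 lerD //.
  rewrite /mode_form ReD; apply: (update_mode_le0 _ tau p l A kappa) => //.
    by rewrite dE ReZ ReD ReZ.
  by rewrite eE ReZ !ReB ReZ.
rewrite /mode_form ImD; apply: (update_mode_le0 _ tau p l A kappa) => //.
  by rewrite dE ImZ ImD ImZ.
by rewrite eE ImZ !ImB ImZ.
Qed.

Theorem theorem2p5 (R : realType) (L : R) (N : nat) (eps tau kappa : R)
    (hL : 0 < L) (hN0 : (0 < N)%N) (hNeven : ~~ odd N)
    (heps : 0 < eps) (htau : 0 < tau) (hkappa : 0 <= kappa)
    (u0 : R * R * R -> R) (hu0 : H1 L u0)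
    (u v : nat -> grid N R)
    (huv : erk2_solution L eps tau kappa (grid_proj L N u0) u v)
    (n : nat) :
  let M := Num.max (norm_oo (u n))
             (Num.max (norm_oo (v n)) (norm_oo (u n.+1))) in
  let beta := (3 * M ^+ 2 - 1) / 2 in
  Num.max (2 * beta - (3 - Num.sqrt 2) * gridh L N ^+ 2 / (3 * pi ^+ 2 * tau))
          0 <= kappa ->
  energy L eps (v n) <= energy L eps (u n) /\
  energy L eps (u n.+1) <= energy L eps (u n).
Proof.
set M := Num.max _ _ => /=; set b := (_ / 2).
rewrite ge_max => /andP[hk _].
have [hs hup] := huv.2 n.
have L0 : L != 0 by rewrite gt_eqF.
have uM : norm_oo (u n) <= M by rewrite le_max lexx.
have vM : norm_oo (v n) <= M by rewrite !le_max lexx orbT.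
have wM : norm_oo (u n.+1) <= M by rewrite !le_max lexx !orbT.
(* The upper bound makes [3 - sqrt 2] nonnegative, as needed in [key]; the lower bound [r1] gives
   [3 - sqrt 2 <= 2], the weaker requirement of the first stage. *)
have r2 : Num.sqrt 2 <= 2 :> R.
  by rewrite -[leRHS]ger0_norm // -sqrtr_sqr ler_wsqrtr // expr2; lra.
have r1 : 1 <= Num.sqrt 2 :> R by rewrite -[leLHS]sqrtr1 ler_wsqrtr //; lra.
(* The hypothesis on [kappa] bounds [2 b - kappa] by a multiple of [h^2 / tau]; multiplying by
   [tau lambda] and using [h^2 lambda <= 3 pi^2] gives a bound uniform in the mode. *)
have key (k : 'I_N * 'I_N * 'I_N) :
    tau * lambda L k * (2 * b - kappa) <= 3 - Num.sqrt 2.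
  have P0 : 0 < 3 * pi ^+ 2 :> R by rewrite mulr_gt0 // exprn_gt0 // pi_gt0.
  have l0 := lambda_ge0 R L N k.
  apply: (@le_trans _ _ (tau * lambda L k *
      ((3 - Num.sqrt 2) * gridh L N ^+ 2 / (3 * pi ^+ 2 * tau)))).
    apply: ler_wpM2l; first by rewrite mulr_ge0 // ltW.
    by rewrite lerBlDl -lerBlDr.
  have -> : tau * lambda L k * ((3 - Num.sqrt 2) * gridh L N ^+ 2 /
      (3 * pi ^+ 2 * tau)) =
      (3 - Num.sqrt 2) * (gridh L N ^+ 2 * lambda L k / (3 * pi ^+ 2)).
    by move: (3 * pi ^+ 2) P0 => P P0; field; rewrite !gt_eqF.
  rewrite -[leRHS]mulr1 ler_wpM2l //; first by lra.
  by rewrite ler_pdivrMr // mul1r lambda_le.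
have L3 : 0 <= L ^+ 3 by rewrite exprn_ge0 // ltW.
have mode0 (k : 'I_N * 'I_N * 'I_N) : lambda L k != 0 ->
    0 < tau * Lambda L eps kappa k /\ 0 < lambda L k.
  move=> ln0; have l0 : 0 < lambda L k by rewrite lt_def ln0 lambda_ge0.
  split=> //; apply: mulr_gt0 => //; apply: ltr_wpDr.
    by rewrite mulr_ge0 // ltW.
  by rewrite mulr_gt0 // exprn_gt0.
have LE (k : 'I_N * 'I_N * 'I_N) : tau * Lambda L eps kappa k =
    tau * lambda L k * (eps ^+ 2 * lambda L k + kappa).
  by rewrite /Lambda; ring.
have cmode_form0 A a fa : cmode_form R A b a fa 0 = 0.
  by rewrite /cmode_form /mode_form /= !expr0n /= !mulr0 !addr0.
split; rewrite -subr_le0.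
  apply: (le_trans (energy_diff_le R L eps M N _ _ hL hN0 uM vM)).
  rewrite mulr_ge0_le0 //; apply: sumr_le0 => k _.
  have dE := dft_stage R L eps tau kappa N _ _ k L0 hs.
  (* A mode with [lambda = 0] is left unchanged by the scheme (conservation of mass), so its form
     vanishes; [phi1_bounds] handles the others. *)
  have [lz|/mode0[z0 l0]] := eqVneq (lambda L k) 0.
    by rewrite dE lz !mulr0 oppr0 rmorph0 mul0r cmode_form0.
  have [p0] := phi1_bounds R _ z0; rewrite {1}LE => h1 _ _.
  apply: (cmode_form_stage_le0 R tau _ _ _ kappa _ _ _ _ htau l0 p0 h1 _ dE).
  by apply: (le_trans (key k)); lra.
(* The step is split at the intermediate stage, but the two majorants are added mode by mode before
   any sign is claimed: the cross term in [d] and [e] is absorbed by both squares together. *)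
rewrite -(subrKA (energy L eps (v n))).
have := lerD (energy_diff_le R L eps M N _ _ hL hN0 uM vM)
  (energy_diff_le R L eps M N _ _ hL hN0 vM wM).
rewrite addrC => /le_trans -> //; rewrite -mulrDr mulr_ge0_le0 //.
rewrite -big_split; apply: sumr_le0 => k _ /=.
have dE := dft_stage R L eps tau kappa N _ _ k L0 hs.
have eE := dft_update R L eps tau kappa N _ _ _ k L0 hs hup.
have [lz|/mode0[z0 l0]] := eqVneq (lambda L k) 0.
  by rewrite eE dE lz !mulr0 oppr0 rmorph0 !mul0r !cmode_form0 addr0.
have [p0] := phi1_bounds R _ z0; rewrite {1 3 5}LE => h1 h2 h3.
have := cmode_form_update_le0 R tau _ _ _ kappa _ _ _ _ _ _
  htau l0 p0 h1 h2 h3 (key k) dE eE.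
(* The base point [a + d] of the second form is the coefficient of [v n]. *)
by rewrite subrKC.
Qed.
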